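(* Let $\tilde{\mathcal{G}}=(\tilde{\mathcal{E}},\tilde{\mathcal{N}})$ be a connected, non-degenerate smoothed gas network graph (as defined in the context) with $n_s$ supply pipes, $n_d$ demand pipes and $n_j$ junction pipes. Let $n_e$ be the number of extra variables and $n_a$ the number of extra algebraic constraints of the assembled network model described in the context. Then $$n_e=n_a=n_s+n_j .$$
   Context: A smoothed gas network graph $\tilde{\mathcal{G}}=(\tilde{\mathcal{E}},\tilde{\mathcal{N}})$ is a finite directed graph whose edges are called pipes. Its nodes are supply nodes, demand nodes and interior nodes. The boundary nodes (nodes incident to exactly one edge) are exactly the supply and demand nodes, and every interior node is a junction node, i.e. it connects at least three edges. An edge attached to a supply node is a supply pipe and is directed away from the supply node. An edge attached to a demand node is a demand pipe and is directed towards the demand node. An edge that is neither a supply pipe nor a demand pipe is called a junction pipe. The degenerate network is the one consisting of a single pipe joining one supply node to one demand node, with no junction node; non-degenerate means that this is not the case. Each pipe $i\in\tilde{\mathcal{E}}$ carries discretized pressures $p^{(i)}_1,\dots,p^{(i)}_{n^{(i)}}$ and discretized mass flows $q^{(i)}_1,\dots,q^{(i)}_{n^{(i)}}$, where index $1$ is the start and index $n^{(i)}$ the end of the pipe. Write $p^{(i)}_s=p^{(i)}_1$ and $q^{(i)}_d=q^{(i)}_{n^{(i)}}$. The internal unknowns of the pipe are $p^{(i)}_2,\dots,p^{(i)}_{n^{(i)}}$ and $q^{(i)}_1,\dots,q^{(i)}_{n^{(i)}-1}$, governed by a system of ordinary differential equations (one equation per internal unknown) in which $p^{(i)}_s$ and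 $q^{(i)}_d$ enter as boundary data. The value $p_s^{(i)}$ is prescribed for each supply pipe and $q_d^{(i)}$ is prescribed for each demand pipe. Assembly of the network model. At every junction node the pressure nodal condition requires all pressures at that node to be equal, i.e. $p^{(i)}_{n^{(i)}}=p^{(j)}_s$ for every incoming pipe $i$ and every outgoing pipe $j$. The mass flow nodal condition at a junction node $k$ is $\sum_{i\in\mathcal{I}_k}q_d^{(i)}=\sum_{i\in\mathcal{O}_k}q_1^{(i)}$, where $\mathcal{I}_k$ and $\mathcal{O}_k$ are the sets of incoming and outgoing pipes of $k$. These conditions are imposed as follows. 1. For every pipe $j$ that starts at a junction node $k$, the value $p_s^{(j)}$ is eliminated by substituting directly the end pressure $p^{(i)}_{n^{(i)}}$ of one selected pipe $i\in\mathcal{I}_k$ (the procedure presupposes that every junction node has at least one incoming pipe). This creates neither an extra variable nor an extra constraint. 2. For every pipe $i$ that is not a demand pipe, $q_d^{(i)}$ is added as an extra variable. The number of these is $n_e$. 3. At every junction node $k$ the following extra algebraic constraints are added: the $|\mathcal{I}_k|-1$ scalar equations expressing equality of the end pressures of all incoming pipes, and the one scalar mass flow nodal condition. The total number of these over all junction nodes is $n_a$. *)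

(* Defs.v *)
From mathcomp Require Import all_boot ssralg.

Set Implicit Arguments.
Unset Strict Implicit.
Unset Printing Implicit Defensive.

Import GRing.Theory.

Inductive node_kind := Supply | Demand | Interior.

(* A finite directed multigraph with edge (pipe) type E and node type N:
   parallel pipes, and loops at interior nodes, are not excluded. *)
Record gas_graph (E N : finType) := GasGraph {
  src : E -> N;
  tgt : E -> N;
  kind : N -> node_kind
}.

Section Graph.
Variables (E N : finType) (G : gas_graph E N).

Definition is_supply (v : N) : bool :=
  if kind G v is Supply then true else false.
Definition is_demand (v : N) : bool :=
  if kind G v is Demand then true else false.
Definition is_interior (v : N) : bool :=
  if kind G v is Interior then true else false.

Definition incident (v : N) : {set E} :=
  [set e | (src G e == v) || (tgt G e == v)].
Definition incoming (v : N) : {set E} := [set e | tgt G e == v].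
Definition outgoing (v : N) : {set E} := [set e | src G e == v].

Definition boundary_node (v : N) : bool := #|incident v| == 1.
Definition junction_node (v : N) : bool := 3 <= #|incident v|.

(* "Directed away from v" includes that the edge does not come back to v. *)
Record smoothed_gas_network : Prop := SmoothedGasNetwork {
  boundary_nodesP : forall v, boundary_node v = is_supply v || is_demand v;
  interior_junction : forall v, is_interior v -> junction_node v;
  supply_directed : forall v e, is_supply v -> e \in incident v ->
    src G e = v /\ tgt G e <> v;
  demand_directed : forall v e, is_demand v -> e \in incident v ->
    tgt G e = v /\ src G e <> v
}.

Definition adjacent : rel N := fun u v =>
  [exists e, (src G e == u) && (tgt G e == v)
          || (src G e == v) && (tgt G e == u)].
Definition connected_graph : Prop := forall u v, connect adjacent u v.

Definition degenerate : Prop :=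
  exists e : E,
    [/\ forall e', e' = e,
        forall v, v = src G e \/ v = tgt G e,
        is_supply (src G e) & is_demand (tgt G e)].

Definition supply_pipes : {set E} :=
  [set e | [exists v, is_supply v && (e \in incident v)]].
Definition demand_pipes : {set E} :=
  [set e | [exists v, is_demand v && (e \in incident v)]].
Definition junction_pipes : {set E} := ~: (supply_pipes :|: demand_pipes).

Definition n_s : nat := #|supply_pipes|.
Definition n_d : nat := #|demand_pipes|.
Definition n_j : nat := #|junction_pipes|.

Lemma junction_nodeE v : smoothed_gas_network ->
  junction_node v = is_interior v.
Proof.
move=> sm; have := boundary_nodesP sm v; have := @interior_junction sm v.
rewrite /boundary_node /junction_node /is_supply /is_demand /is_interior.
by case: (kind G v) => [_ /eqP->|_ /eqP->|->].
Qed.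

Lemma supply_pipeE (i : E) : smoothed_gas_network ->
  (i \in supply_pipes) = ~~ junction_node (src G i).
Proof.
move=> sm; rewrite inE junction_nodeE //; apply/existsP/idP => [[v]|si].
  case/andP=> sv iv; have [-> _] := supply_directed sm sv iv.
  by move: sv; rewrite /is_supply /is_interior; case: kind.
exists (src G i); have inc : i \in incident (src G i) by rewrite inE eqxx.
rewrite inc andbT; case dv: (is_demand (src G i)).
  by have [_ []] := demand_directed sm dv inc.
by move: si dv; rewrite /is_supply /is_demand /is_interior; case: kind.
Qed.

Section Assembly.

(* Pipe i has (m i).+1 discretization points, numbered from 0, so that ord0
   is the start of the pipe and ord_max its end. *)
Variable m : E -> nat.

(* The discretized pressures (left) and mass flows (right) of all pipes. *)
Definition quantity : finType :=
  ({i : E & 'I_(m i).+1} + {i : E & 'I_(m i).+1})%type.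

Definition pressure (i : E) (x : 'I_(m i).+1) : quantity :=
  inl (Tagged (fun i => 'I_(m i).+1) x).
Definition mass_flow (i : E) (x : 'I_(m i).+1) : quantity :=
  inr (Tagged (fun i => 'I_(m i).+1) x).

Definition p_start (i : E) : quantity := @pressure i ord0.
Definition p_end (i : E) : quantity := @pressure i ord_max.
Definition q_start (i : E) : quantity := @mass_flow i ord0.
Definition q_end (i : E) : quantity := @mass_flow i ord_max.

(* The unknowns governed by the differential equations of the pipes; these
   equations do not enter the counts below. *)
Definition internal_unknowns : {set quantity} :=
  [set v : quantity | match v with
                      | inl u => tagged u != ord0
                      | inr u => tagged u != ord_max
                      end].
Definition prescribed : {set quantity} :=
  [set p_start i | i in supply_pipes] :|: [set q_end i | i in demand_pipes].
Definition substituted : {set quantity} :=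
  [set p_start j | j in [set j | junction_node (src G j)]].
Definition extra_variables : {set quantity} :=
  [set q_end i | i in ~: demand_pipes].
Definition n_e : nat := #|extra_variables|.

Lemma mem_p_start i (x : 'I_(m i).+1) (A : {set E}) :
  (pressure x \in [set p_start j | j in A]) = (x == ord0) && (i \in A).
Proof.
apply/imsetP/andP => [[j jA [e]]|[/eqP-> iA]]; last by exists i.
subst j => H; split=> //; apply/eqP.
exact: (@eq_from_Tagged E (fun i => 'I_(m i).+1) _ _ _ H).
Qed.

Lemma mem_q_end i (x : 'I_(m i).+1) (A : {set E}) :
  (mass_flow x \in [set q_end j | j in A]) = (x == ord_max) && (i \in A).
Proof.
apply/imsetP/andP => [[j jA [e]]|[/eqP-> iA]]; last by exists i.
subst j => H; split=> //; apply/eqP.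
exact: (@eq_from_Tagged E (fun i => 'I_(m i).+1) _ _ _ H).
Qed.

Lemma pressure_notin_q_end i (x : 'I_(m i).+1) (A : {set E}) :
  (pressure x \in [set q_end j | j in A]) = false.
Proof. by apply/imsetP => -[]. Qed.

Lemma mass_flow_notin_p_start i (x : 'I_(m i).+1) (A : {set E}) :
  (mass_flow x \in [set p_start j | j in A]) = false.
Proof. by apply/imsetP => -[]. Qed.

(* Every discretized quantity is exactly one of: internal unknown, boundary
   value, eliminated start pressure, extra variable. *)
Lemma quantity_classes (v : quantity) : smoothed_gas_network ->
  (v \in internal_unknowns) + (v \in prescribed) + (v \in substituted)
    + (v \in extra_variables) = 1.
Proof.
move=> sm; case: v => -[i x].
- have -> : inl (existT _ i x) = pressure x by [].
  rewrite inE in_setU pressure_notin_q_end mem_p_start.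
  rewrite mem_p_start pressure_notin_q_end (supply_pipeE _ sm) !inE /=.
  by case: (x == ord0); case: junction_node.
- have -> : inr (existT _ i x) = mass_flow x by [].
  rewrite inE in_setU mass_flow_notin_p_start mem_q_end.
  rewrite mass_flow_notin_p_start mem_q_end in_setC /=.
  by case: (x == ord_max); case: (i \in _).
Qed.

(* The scalar equation: sum of the left list = sum of the right list. *)
Record equation := Equation { lhs : seq quantity; rhs : seq quantity }.

Definition holds (R : nmodType) (x : quantity -> R) (eq : equation) : bool :=
  (\sum_(v <- lhs eq) x v == \sum_(v <- rhs eq) x v)%R.

(* sel k is the incoming pipe of the junction k whose end pressure replaces
   the start pressures of the outgoing pipes of k. *)
Variable sel : N -> E.

Definition selection : Prop :=
  forall k, junction_node k -> sel k \in incoming k.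

Definition pressure_constraints (k : N) : seq equation :=
  [seq Equation [:: p_end i] [:: p_end (sel k)]
     | i <- enum (incoming k :\ sel k)].

Definition mass_flow_constraint (k : N) : equation :=
  Equation [seq q_end i | i <- enum (incoming k)]
           [seq q_start i | i <- enum (outgoing k)].

Definition extra_constraints : seq equation :=
  flatten [seq rcons (pressure_constraints k) (mass_flow_constraint k)
             | k <- enum [pred k | junction_node k]].
Definition n_a : nat := size extra_constraints.

(* Once the start pressures are substituted, the extra constraints amount to
   the nodal conditions at the junctions. *)
Lemma extra_constraintsP (R : nmodType) (x : quantity -> R) :
  selection ->
  (forall j, junction_node (src G j) ->
     x (p_start j) = x (p_end (sel (src G j)))) ->
  all (holds x) extra_constraints <->
  (forall k, junction_node k ->
     [/\ {in incoming k &, forall i i', x (p_end i) = x (p_end i')},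
         {in incoming k & outgoing k,
            forall i j, x (p_end i) = x (p_start j)}
       & (\sum_(i in incoming k) x (q_end i)
          = \sum_(i in outgoing k) x (q_start i))%R]).
Proof.
move=> selP sub.
have allF (a : pred equation) ss : all a (flatten ss) = all (all a) ss.
  by elim: ss => //= t ss IH; rewrite all_cat IH.
rewrite allF all_map.
have allE k : all (holds x) (rcons (pressure_constraints k)
                                   (mass_flow_constraint k)) =
    all (fun i => x (p_end i) == x (p_end (sel k))) (enum (incoming k :\ sel k))
    && (\sum_(i in incoming k) x (q_end i)
        == \sum_(i in outgoing k) x (q_start i))%R.
  rewrite all_rcons andbC all_map; congr (_ && _).
    by apply: eq_all => i; rewrite /holds /= !big_seq1.
  by rewrite /holds /= !big_map !big_enum.
split=> [/allP ok k jk | ok].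
  have := ok k; rewrite mem_enum => /(_ jk) /=; rewrite allE.
  case/andP=> /allP eqp /eqP flow.
  have eq_sel i : i \in incoming k -> x (p_end i) = x (p_end (sel k)).
    move=> ik; have [->//|nik] := eqVneq i (sel k).
    by apply/eqP/eqp; rewrite mem_enum !inE nik; rewrite inE in ik.
  split=> // [i i' ik ik'|i j ik]; first by rewrite !eq_sel.
  by rewrite inE => /eqP jE; rewrite sub jE // eq_sel.
apply/allP=> k; rewrite mem_enum => jk /=; rewrite allE.
have [eqp _ ->] := ok k jk; rewrite eqxx andbT; apply/allP => i.
by rewrite mem_enum in_setD1 => /andP[_ ik]; rewrite (eqp i (sel k)) ?selP.
Qed.

End Assembly.
End Graph.

(* Main.v *)
Require Import Defs.
From mathcomp Require Import all_boot.

(** Both counts equal the number of pipes that are not demand pipes.  These are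
    exactly the pipes ending at a junction node, and each junction [k]
    contributes [(|I_k| - 1) + 1 = |I_k|] constraints.  By connectedness, a pipe
    that is both a supply and a demand pipe is the whole network, so in the
    non-degenerate case the non-demand pipes split into the supply pipes and
    the junction pipes. *)

Section Counting.
Set Implicit Arguments.
Unset Strict Implicit.
Unset Printing Implicit Defensive.

Variables (E N : finType) (G : gas_graph E N).
Hypothesis Gsmoothed : smoothed_gas_network G.

Lemma boundary_pipe_unique v e e' : is_supply G v || is_demand G v ->
  e \in incident G v -> e' \in incident G v -> e' = e.
Proof.
rewrite -(boundary_nodesP Gsmoothed) => /cards1P[f ->].
by rewrite !inE => /eqP-> /eqP->.
Qed.

Lemma supply_pipe_src e : e \in supply_pipes G -> is_supply G (src G e).
Proof.
rewrite inE => /existsP[v /andP[sv ev]].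
by have [-> _] := supply_directed Gsmoothed sv ev.
Qed.

Lemma demand_pipe_tgt e : e \in demand_pipes G -> is_demand G (tgt G e).
Proof.
rewrite inE => /existsP[v /andP[dv ev]].
by have [-> _] := demand_directed Gsmoothed dv ev.
Qed.

(** A pipe cannot end at a supply node, since supply pipes point away from it; so an end that is no
    junction is a demand node. *)
Lemma demand_pipeE e : (e \in demand_pipes G) = ~~ junction_node G (tgt G e).
Proof.
rewrite junction_nodeE //; apply/idP/idP => [/demand_pipe_tgt|ni].
  by rewrite /is_demand /is_interior; case: kind.
have et : e \in incident G (tgt G e) by rewrite inE eqxx orbT.
rewrite inE; apply/existsP; exists (tgt G e); rewrite et andbT.
have [st|] := boolP (is_supply G (tgt G e)).
  by have [_ []] := supply_directed Gsmoothed st et.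
by move: ni; rewrite /is_supply /is_demand /is_interior; case: kind.
Qed.

Lemma adjacent_sym : symmetric (adjacent G).
Proof. by move=> u v; apply: eq_existsb => e; rewrite orbC. Qed.

Lemma supply_demand_disjoint : connected_graph G -> ~ degenerate G ->
  [disjoint supply_pipes G & demand_pipes G].
Proof.
move=> Gconnected ndeg; apply/pred0P => e /=; apply/negP => /andP[es ed].
have ss := supply_pipe_src es; have dt := demand_pipe_tgt ed.
pose ends := pred2 (src G e) (tgt G e).
have uniq_e e' v : v \in ends -> e' \in incident G v -> e' = e.
  case/pred2P=> ->; apply: boundary_pipe_unique; rewrite ?ss ?dt ?orbT //;
  by rewrite inE eqxx ?orbT.
(* Both ends of [e] are boundary nodes carrying only [e], so no adjacency leaves the pair;
   connectedness then makes it the whole node set. *)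
have ends_closed : closed (adjacent G) ends.
  apply: intro_closed => [|x y /existsP[e' adj] xe].
    exact/sym_connect_sym/adjacent_sym.
  have e'E : e' = e.
    apply: uniq_e xe _; rewrite inE.
    by case/orP: adj => /andP[sx tx]; rewrite ?sx ?tx ?orbT.
  move: adj; rewrite e'E.
  by case/orP=> /andP[/eqP se /eqP te]; rewrite -?se -?te inE eqxx ?orbT.
have all_ends v : v \in ends.
  rewrite -(closed_connect ends_closed (Gconnected (src G e) v)).
  by rewrite inE eqxx.
apply: ndeg; exists e; split=> // [e'|v]; last exact/pred2P/all_ends.
(* Any pipe [e'] starts at an end of [e], hence equals [e]. *)
by apply: uniq_e (all_ends (src G e')) _; rewrite inE eqxx.
Qed.

Lemma card_nondemand_pipes : connected_graph G -> ~ degenerate G ->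
  #|~: demand_pipes G| = n_s G + n_j G.
Proof.
move=> Gconnected ndeg.
have disj := supply_demand_disjoint Gconnected ndeg.
rewrite -(cardsID (supply_pipes G)) /n_s /n_j /junction_pipes; congr (_ + _).
  by apply/eq_card => e; rewrite in_setI in_setC andb_idl // => /(disjointFr disj)->.
by apply/eq_card => e; rewrite in_setD !in_setC in_setU negb_or.
Qed.

(** The non-demand pipes are partitioned by their end node, which is always a junction. *)
Lemma sum_card_incoming_junctions :
  \sum_(k | junction_node G k) #|incoming G k| = #|~: demand_pipes G|.
Proof.
rewrite -sum1_card (partition_big (tgt G) (junction_node G)) /=; last first.
  by move=> e; rewrite in_setC demand_pipeE negbK.
apply: eq_bigr => k jk; rewrite -sum1_card; apply: eq_bigl => e.
rewrite in_setC demand_pipeE negbK inE.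
by case: eqP => [->|]; rewrite ?jk ?andbF.
Qed.

Variable m : E -> nat.

Lemma n_eE : n_e G m = #|~: demand_pipes G|.
Proof.
apply: card_imset => i j ij.
(* [q_end] is injective because its value carries the pipe as tag; the default [i] serves only
   pressures and is never reached. *)
by have /(congr1 (fun v => if v is inr u then tag u else i)) := ij.
Qed.

Lemma n_aE (sel : N -> E) : selection G sel ->
  n_a G m sel = \sum_(k | junction_node G k) #|incoming G k|.
Proof.
move=> selP.
rewrite /n_a /extra_constraints size_flatten /shape -map_comp sumnE big_map.
rewrite big_enum; apply: eq_bigr => k jk /=.
(* The mass flow equation makes up for the selected pipe [sel k], which has no pressure equation of
   its own. *)
by rewrite size_rcons size_map -cardE (cardsD1 (sel k) (incoming G k)) selP.
Qed.

End Counting.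

Theorem proposition3p1 (E N : finType) (G : gas_graph E N)
    (m : E -> nat) (sel : N -> E)
    (Gsmoothed : smoothed_gas_network G)
    (Gconnected : connected_graph G)
    (Gnondegenerate : ~ degenerate G)
    (selP : selection G sel) :
  n_e G m = n_a G m sel /\ n_a G m sel = n_s G + n_j G.
Proof.
by rewrite n_aE // sum_card_incoming_junctions // n_eE card_nondemand_pipes.
Qed.
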